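(* Let $d\geqslant 2$ be an integer. Define $$\mathcal Z_{d,W}=\Bigl\{\mathbf x\in \mathsf T_d:~\liminf_{N\to \infty} |S_d(\mathbf x; N)|=0\Bigr\}\qquad\text{and}\qquad \mathcal Z_{d,G}=\Bigl\{x\in \mathsf T:~\liminf_{N\to \infty} |G_d(x; N)|=0\Bigr\}.$$ Then $\mathcal Z_{d,W}$ contains a dense $\mathcal G_\delta$ subset of $\mathsf T_d$, and $\mathcal Z_{d,G}$ contains a dense $\mathcal G_\delta$ subset of $\mathsf T$.
   Context: $\mathsf T_d=(\mathbb R/\mathbb Z)^d$ is the $d$-dimensional unit torus and $\mathsf T=\mathsf T_1=\mathbb R/\mathbb Z$. Write $e(x)=\exp(2\pi i x)$. For $\mathbf x=(x_1,\ldots,x_d)\in\mathsf T_d$ and $N\in\mathbb N$, the Weyl sum is $S_d(\mathbf x;N)=\sum_{n=1}^N e(x_1n+\cdots+x_dn^d)$, and for $x\in\mathsf T$ the monomial sum is $G_d(x;N)=\sum_{n=1}^N e(xn^d)$. A $\mathcal G_\delta$ set is a countable intersection of open sets. *)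

(* Defs.v *)
From HB Require Import structures.
From mathcomp Require Import all_boot all_order all_algebra.
From mathcomp Require Import all_classical all_reals all_analysis.
From mathcomp Require Import borel_hierarchy complex.

Set Implicit Arguments.
Unset Strict Implicit.
Unset Printing Implicit Defensive.

Import Order.TTheory GRing.Theory Num.Theory.
Import numFieldNormedType.Exports.

Local Open Scope classical_set_scope.
Local Open Scope ring_scope.
Local Open Scope quotient_scope.
Local Open Scope complex_scope.

(* The predicate behind [Num.int], as an additive subgroup of [R]. *)
Definition int_subgroup (R : realType) : zmodClosed R :=
  GRing.ZmodClosed.clone R (@Num.int_num_subdef R) _.

Definition torus1 (R : realType) : Type := {ideal_quot (int_subgroup R)}.

(* The topology comes first: the choice structures of [{ideal_quot _}] and of
   [quotient_topology _] differ, so the group law of the quotient is rebuilt on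
   top of the latter rather than inherited. *)
HB.instance Definition _ (R : realType) :=
  Topological.copy (torus1 R) (quotient_topology {ideal_quot (int_subgroup R)}).
HB.instance Definition _ (R : realType) := Quotient.on (torus1 R).
HB.instance Definition _ (R : realType) :=
  GRing.isZmodule.Build (torus1 R)
    (@ring_quotient.Quotient.addqA R (int_subgroup R))
    (@ring_quotient.Quotient.addqC R (int_subgroup R))
    (@ring_quotient.Quotient.add0q R (int_subgroup R))
    (@ring_quotient.Quotient.addNq R (int_subgroup R)).

Definition torus (R : realType) (d : nat) : Type := {ptws 'I_d -> torus1 R}.

HB.instance Definition _ (R : realType) (d : nat) :=
  Topological.copy (torus R d) {ptws 'I_d -> torus1 R}.

Definition expi (R : realType) (t : R) : R[i] := cos t +i* sin t.

(* [torus_e_pi] shows that the value does not depend on the representative. *)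
Definition torus_e (R : realType) (x : torus1 R) : R[i] :=
  expi (2 * pi * repr x).

(* The coordinate x_j (1 <= j <= d) is [x i] with j = i + 1, and x_j n^j is
   the multiple [x i *+ n ^ i.+1] in the group R/Z. *)
Definition weyl_sum (R : realType) (d : nat) (x : torus R d) (N : nat) : R[i] :=
  \sum_(1 <= n < N.+1) torus_e (\sum_(i < d) x i *+ n ^ i.+1).

Definition monomial_sum (R : realType) (d : nat) (x : torus1 R) (N : nat) :
    R[i] :=
  \sum_(1 <= n < N.+1) torus_e (x *+ n ^ d).

Definition ZW (R : realType) (d : nat) : set (torus R d) :=
  [set x | limn_einf (fun N => (Normc.normc (weyl_sum x N))%:E) = 0%E].

Definition ZG (R : realType) (d : nat) : set (torus1 R) :=
  [set x | limn_einf (fun N => (Normc.normc (monomial_sum d x N))%:E) = 0%E].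

Definition contains_dense_Gdelta (T : topologicalType) (Z : set T) : Prop :=
  exists A : set T, [/\ Gdelta A, dense A & A `<=` Z].

Lemma expi_period (R : realType) (t : R) (k : int) :
  expi (t + 2 * pi * k%:~R) = expi t.
Proof.
suff nat_period (u : R) (n : nat) : expi (u + 2 * pi * n%:R) = expi u.
  case: k => n; first exact: nat_period.
  rewrite NegzE -[RHS](nat_period _ n.+1) -[LHS](nat_period _ n.+1).
  by rewrite mulrNz mulrN subrK nat_period.
rewrite /expi mulr_natr mulr_natl.
by rewrite (periodicn (@cosD2pi R)) (periodicn (@sinD2pi R)).
Qed.

Lemma torus_e_pi (R : realType) (t : R) :
  torus_e (\pi_(torus1 R) t) = expi (2 * pi * t).
Proof.
have : t - repr (\pi_(torus1 R) t) \in int_subgroup R.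
  by rewrite ring_quotient.Quotient.idealrBE reprK.
rewrite /torus_e; move: (repr _) => r /intrP[k trk].
by rewrite -(expi_period _ k) -mulrDr -trk addrC subrK.
Qed.

Lemma torus1_piD (R : realType) :
  {morph (\pi_(torus1 R) : R -> torus1 R) : x y / x + y}.
Proof. exact: ring_quotient.Quotient.pi_add. Qed.

Lemma torus1_pi0 (R : realType) : \pi_(torus1 R) 0 = 0 :> torus1 R.
Proof.
by apply: (addrI (\pi_(torus1 R) 0 : torus1 R)); rewrite -torus1_piD !addr0.
Qed.

Lemma torus1_piMn (R : realType) (x : R) (m : nat) :
  \pi_(torus1 R) (x *+ m) = (\pi_(torus1 R) x : torus1 R) *+ m.
Proof.
by elim: m => [|m IH]; rewrite ?mulr0n ?torus1_pi0// !mulrS torus1_piD IH.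
Qed.

Lemma weyl_sum_pi (R : realType) (d : nat) (t : 'I_d -> R) (N : nat) :
  weyl_sum ((fun i => \pi_(torus1 R) (t i)) : torus R d) N =
  \sum_(1 <= n < N.+1) expi (2 * pi * \sum_(i < d) t i * n%:R ^+ i.+1).
Proof.
apply: eq_bigr => n _; rewrite -torus_e_pi; congr torus_e.
rewrite (big_morph _ (@torus1_piD R) (torus1_pi0 R)).
by apply: eq_bigr => i _; rewrite -natrX mulr_natr torus1_piMn.
Qed.

Lemma monomial_sum_pi (R : realType) (d : nat) (t : R) (N : nat) :
  monomial_sum d (\pi_(torus1 R) t) N =
  \sum_(1 <= n < N.+1) expi (2 * pi * (t * n%:R ^+ d)).
Proof.
apply: eq_bigr => n _; rewrite -torus_e_pi; congr torus_e.
by rewrite -natrX mulr_natr torus1_piMn.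
Qed.

(* Main.v *)
(** The set of points at which infinitely many of the continuous functions
    [|S_N|] take arbitrarily small values is a [G_delta], so it suffices to find
    a dense set of points at which [S_N = 0] for infinitely many [N].

    If the phase changes by [1/2] modulo [1] under [n |-> n + m], the terms of
    the sum satisfy [f (n + m) = - f n], so that any [2m] consecutive terms
    cancel and [S_N = 0] whenever [2m] divides [N].  This happens for the Weyl
    sum at [x_1 = (b_1 + 1/2) / m], [x_j = b_j / m] ([j > 1]) with integers
    [b_j].  For the monomial sum it happens at [x = (b + 1/2) / m] with [m] odd,
    because [(n + m)^d - n^d] is then an odd multiple of [m]. *)

Require Import Defs.
From mathcomp Require Import all_boot all_order all_algebra.
From mathcomp Require Import all_classical all_reals all_analysis.
From mathcomp Require Import borel_hierarchy complex ring lra.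

Set Implicit Arguments.
Unset Strict Implicit.
Unset Printing Implicit Defensive.

Import Order.TTheory GRing.Theory Num.Theory.
Import numFieldNormedType.Exports.

Local Open Scope classical_set_scope.
Local Open Scope ring_scope.
Local Open Scope quotient_scope.
Local Open Scope complex_scope.

(* [Re] and [Im] would otherwise be the [R[i]]-valued projections of [Num]. *)
Local Notation Re := complex.Re.
Local Notation Im := complex.Im.

(** * Lower limits, dense G_delta sets and density of images *)

Lemma limn_einf_eq0 (R : realType) (u : nat -> R) :
  (forall N, 0 <= u N) ->
  (forall k, exists2 N, (k <= N)%N & u N < k.+1%:R^-1) ->
  limn_einf (fun N => (u N)%:E) = 0%E.
Proof.
move=> u0 usmall; rewrite limn_einf_lim.
(* Every tail infimum is already 0, so the sequence of infima is constant. *)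
suff -> : einfs (fun N => (u N)%:E) = cst 0%E by rewrite lim_cst.
apply/funext => n; apply/eqP; rewrite eq_le; apply/andP; split; last first.
  by apply: le_ereal_inf_tmp => _ [N _ <-]; rewrite lee_fin.
apply/lee_addgt0Pr => e e0; rewrite add0e.
have [k [nk ke]] : exists k, (n <= k)%N /\ k.+1%:R^-1 < e.
  have [k /= _ kP] := near_infty_natSinv_lt (PosNum e0).
  (* The maximum puts the index in the tail from [n] and the threshold below [e]. *)
  exists (maxn n k); split; first exact: leq_maxl.
  exact/kP/leq_maxr.
have [N kN uN] := usmall k.
apply: le_trans (_ : (u N)%:E <= _)%E.
  by apply: ereal_inf_lbound; exists N => //=; exact: leq_trans nk kN.
by rewrite lee_fin; exact/ltW/(lt_trans uN).
Qed.

Lemma contains_dense_Gdelta_liminf (R : realType) (T : topologicalType)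
    (s : nat -> T -> R) (D : set T) :
  (forall N, continuous (s N)) -> (forall N x, 0 <= s N x) -> dense D ->
  (forall x, D x -> forall k, exists2 N, (k <= N)%N & s N x = 0) ->
  contains_dense_Gdelta [set x | limn_einf (fun N => (s N x)%:E) = 0%E].
Proof.
move=> sC s0 Dd Ds.
pose U k := \bigcup_(N in [set N | (k <= N)%N])
  (s N @^-1` [set y | y < k.+1%:R^-1]).
exists (\bigcap_k U k); split.
- exists U => // k; apply: bigcup_open => N _.
  by move: (sC N) => /continuousP; apply; exact: open_lt.
(* No Baire argument: every [U k] contains [D], hence so does the intersection. *)
- move=> O O0 oO; have [x [Ox Dx]] := Dd O O0 oO.
  exists x; split=> // k _; have [N kN sN] := Ds x Dx k.
  by exists N => //=; rewrite sN invr_gt0.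
- move=> x Ux; apply: limn_einf_eq0 => // k.
  by have [N /= kN sN] := Ux k I; exists N.
Qed.

Lemma dense_image (S T : topologicalType) (p : S -> T) (D : set S) :
  continuous p -> (forall y, exists x, p x = y) -> dense D -> dense (p @` D).
Proof.
move=> /continuousP pC psurj Dd O [y Oy] oO; have [x xy] := psurj y.
have [z [Oz Dz]] : (p @^-1` O) `&` D !=set0.
  by apply: Dd (pC _ oO); exists x; rewrite /= xy.
by exists (p z); split=> //; exists z.
Qed.

(** * Continuity of complex-valued maps, through real and imaginary parts *)

Definition complex_continuous (R : realType) (T : topologicalType)
    (f : T -> R[i]) :=
  continuous (fun x => Re (f x)) /\ continuous (fun x => Im (f x)).

Section complex_continuous.
Context {R : realType} {T : topologicalType}.
Implicit Types f g : T -> R[i].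

Lemma complex_continuous_cst (z : R[i]) :
  complex_continuous (fun _ : T => z).
Proof. by split=> x; exact: cvg_cst. Qed.

Lemma complex_continuousD f g : complex_continuous f -> complex_continuous g ->
  complex_continuous (fun x => f x + g x).
Proof.
move=> [fr fi] [gr gi]; split=> x; under eq_fun do rewrite raddfD.
  exact: cvgD (fr x) (gr x).
exact: cvgD (fi x) (gi x).
Qed.

Lemma complex_continuousM f g : complex_continuous f -> complex_continuous g ->
  complex_continuous (fun x => f x * g x).
Proof.
move=> [fr fi] [gr gi]; split=> x.
- have -> : (fun y => Re (f y * g y)) =
      (fun y => Re (f y) * Re (g y) - Im (f y) * Im (g y)).
    by apply/funext => y; case: (f y) (g y) => ? ? [].
  exact: cvgB (cvgM (fr x) (gr x)) (cvgM (fi x) (gi x)).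
- have -> : (fun y => Im (f y * g y)) =
      (fun y => Re (f y) * Im (g y) + Im (f y) * Re (g y)).
    by apply/funext => y; case: (f y) (g y) => ? ? [].
  exact: cvgD (cvgM (fr x) (gi x)) (cvgM (fi x) (gr x)).
Qed.

Lemma complex_continuousX f n : complex_continuous f ->
  complex_continuous (fun x => f x ^+ n).
Proof.
move=> fC; elim: n => [|n IH]; first exact: complex_continuous_cst.
under eq_fun do rewrite exprS.
exact: complex_continuousM.
Qed.

Lemma complex_continuous_sum (I : Type) (r : seq I) (F : I -> T -> R[i]) :
  (forall i, complex_continuous (F i)) ->
  complex_continuous (fun x => \sum_(i <- r) F i x).
Proof.
move=> FC; elim: r => [|i r IH].
  by under eq_fun do rewrite big_nil; exact: complex_continuous_cst.
by under eq_fun do rewrite big_cons; exact: complex_continuousD.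
Qed.

Lemma complex_continuous_prod (I : Type) (r : seq I) (F : I -> T -> R[i]) :
  (forall i, complex_continuous (F i)) ->
  complex_continuous (fun x => \prod_(i <- r) F i x).
Proof.
move=> FC; elim: r => [|i r IH].
  by under eq_fun do rewrite big_nil; exact: complex_continuous_cst.
by under eq_fun do rewrite big_cons; exact: complex_continuousM.
Qed.

Lemma continuous_normc f : complex_continuous f ->
  continuous (fun x => Normc.normc (f x)).
Proof.
move=> [fr fi] x.
have -> : (fun y => Normc.normc (f y)) =
    (fun y => Num.sqrt (Re (f y) * Re (f y) + Im (f y) * Im (f y))).
  by apply/funext => y; case: (f y).
apply: (@continuous_comp _ _ _
  (fun y => Re (f y) * Re (f y) + Im (f y) * Im (f y)) Num.sqrt).
  exact: cvgD (cvgM (fr x) (fr x)) (cvgM (fi x) (fi x)).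
exact: sqrt_continuous.
Qed.

Lemma complex_continuous_comp (S : topologicalType) (h : S -> T) f :
  continuous h -> complex_continuous f ->
  complex_continuous (fun x => f (h x)).
Proof.
move=> hC [fr fi]; split=> x.
  exact: (continuous_comp (hC x) (fr (h x))).
exact: (continuous_comp (hC x) (fi (h x))).
Qed.

End complex_continuous.

(** * The character on R/Z and continuity of the exponential sums *)

Lemma expiD (R : realType) (s t : R) : expi (s + t) = expi s * expi t.
Proof.
rewrite /expi cosD sinD; congr (_ +i* _).
by rewrite addrC [X in _ + X]mulrC [X in X + _]mulrC addrC mulrC.
Qed.

Lemma expi0 (R : realType) : expi (0 : R) = 1.
Proof. by rewrite /expi cos0 sin0. Qed.

Lemma expi_half_turn (R : realType) (s t : R) :
  s - t - 2^-1 \is a Num.int -> expi (2 * pi * s) = - expi (2 * pi * t).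
Proof.
move=> /intrP[k sk].
have -> : s = t + 2^-1 + k%:~R by rewrite -sk; ring.
rewrite mulrDr expi_period mulrDr expiD.
have -> : 2 * pi * 2^-1 = pi :> R by field.
by rewrite /expi cospi sinpi -[-1 +i* 0]/((-1)%:C) rmorphN1 mulrN1.
Qed.

Section torus_e.
Context {R : realType}.

Lemma torus_eD (x y : torus1 R) : torus_e (x + y) = torus_e x * torus_e y.
Proof.
rewrite -[x]reprK -[y]reprK -torus1_piD !torus_e_pi mulrDr.
exact: expiD.
Qed.

Lemma torus_e0 : torus_e (0 : torus1 R) = 1.
Proof. by rewrite -torus1_pi0 torus_e_pi mulr0 expi0. Qed.

Lemma torus_eMn (x : torus1 R) n : torus_e (x *+ n) = torus_e x ^+ n.
Proof.
by elim: n => [|n IH]; rewrite ?mulr0n ?torus_e0// mulrS torus_eD IH exprS.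
Qed.

Lemma torus1_pi_continuous : continuous (\pi_(torus1 R) : R -> torus1 R).
Proof. exact: pi_continuous. Qed.

(** By the universal property of the quotient topology it is enough to compose with the projection;
    [torus_e_pi] then removes the chosen representative and leaves a cosine and a sine. *)
Lemma torus_e_continuous : complex_continuous (@torus_e R).
Proof.
have tC : continuous (fun t : R => 2 * pi * t) by exact: mulrl_continuous.
split; apply/quotient_continuous.
- suff -> : (fun x => Re (torus_e x)) \o \pi_(torus1 R) =
    (fun t : R => cos (2 * pi * t)).
    by move=> t; apply: (continuous_comp (tC t)); exact: continuous_cos.
  by apply/funext => t; rewrite -[LHS]/(Re (torus_e (\pi t))) torus_e_pi.
- suff -> : (fun x => Im (torus_e x)) \o \pi_(torus1 R) =
    (fun t : R => sin (2 * pi * t)).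
    by move=> t; apply: (continuous_comp (tC t)); exact: continuous_sin.
  by apply/funext => t; rewrite -[LHS]/(Im (torus_e (\pi t))) torus_e_pi.
Qed.

Lemma monomial_sum_continuous d N :
  complex_continuous (fun x : torus1 R => monomial_sum d x N).
Proof.
apply: complex_continuous_sum => n; under eq_fun do rewrite torus_eMn.
exact: complex_continuousX torus_e_continuous.
Qed.

(** Since [torus_e] is a character, each term is a product of powers of [torus_e] at the
    coordinates; continuity of addition on [torus1 R] never enters. *)
Lemma weyl_sum_continuous d N :
  complex_continuous (fun x : torus R d => weyl_sum x N).
Proof.
apply: complex_continuous_sum => n.
under eq_fun do rewrite (big_morph _ torus_eD torus_e0).
apply: complex_continuous_prod => i; under eq_fun do rewrite torus_eMn.
apply: complex_continuousX; apply: complex_continuous_comp torus_e_continuous.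
exact: (@proj_continuous 'I_d (fun=> torus1 R) i).
Qed.

(** Row vectors serve as the covering space because their balls are entrywise: density upstairs
    amounts to approximating every coordinate within one radius. *)
Definition torus_pi d (t : 'rV[R]_d) : torus R d :=
  fun i => \pi_(torus1 R) (t 0 i).

Lemma torus_pi_continuous d : continuous (@torus_pi d).
Proof.
(* The pointwise topology is the supremum of the initial topologies of the coordinates, so each
   coordinate is treated alone. *)
move=> t; apply/cvg_sup; first exact/fmap_filter/nbhs_filter.
move=> i A [_ [[B oB <-] Bt BA]].
have : nbhs t ((fun u : 'rV[R]_d => \pi_(torus1 R) (u 0 i) : torus1 R) @^-1` B).
  apply: (@continuous_comp _ _ _ (fun u : 'rV[R]_d => u 0 i)
    (\pi_(torus1 R) : R -> torus1 R)).
  - exact: coord_continuous.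
  - exact: torus1_pi_continuous.
  - exact: open_nbhs_nbhs.
by apply: filterS => u Bu; exact: BA.
Qed.

End torus_e.

(** * Cancellation over blocks and half-integer phase shifts *)

Lemma sum_antiperiodic (V : zmodType) (f : nat -> V) (m k : nat) :
  (forall n, f (n + m)%N = - f n) ->
  \sum_(1 <= n < (k * m.*2).+1) f n = 0.
Proof.
move=> fm; elim: k => [|k IH]; first by rewrite mul0n big_geq.
(* [a] is the first index of the last block of [2m] terms, whose second half is the opposite of its
   first half. *)
set a := (k * m.*2).+1 in IH.
have -> : (k.+1 * m.*2).+1 = (a + m + m)%N.
  by rewrite /a mulSn -addnn addSn; congr _.+1; rewrite addnC addnA.
rewrite (big_cat_nat _ (n := a)) ?IH//=; last by rewrite -addnA leq_addr.
rewrite (big_cat_nat _ (n := a + m)) ?leq_addr//=.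
rewrite (big_addn a (a + m + m) m) addnK.
have -> : \sum_(a <= n < a + m) f (n + m)%N = - \sum_(a <= n < a + m) f n.
  by rewrite -sumrN; apply: eq_bigr => n _; exact: fm.
by rewrite subrr addr0.
Qed.

(** Divisibility comes from n + m = n modulo m. For the parity of [c]: positive powers preserve
    parity and an odd [m] flips that of [n], so [c * m] is odd. *)
Lemma expn_shift (n m j : nat) :
  exists2 c, ((n + m) ^ j = n ^ j + c * m)%N & (0 < j)%N -> odd m -> odd c.
Proof.
have : (n ^ j <= (n + m) ^ j)%N by case: j => // j; rewrite leq_exp2r ?leq_addr.
move=> le; have : (m %| (n + m) ^ j - n ^ j)%N.
  by rewrite -eqn_mod_dvd// -modnXm modnDr modnXm.
move=> /dvdnP[c cE].
have E : ((n + m) ^ j = n ^ j + c * m)%N by rewrite -cE subnKC.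
exists c => // j0 om; move: (congr1 odd E).
rewrite oddD oddM om andbT !oddX (gtn_eqF j0) /= oddD om.
by case: (odd n); case: (odd c).
Qed.

(** One denominator works for all [t] and [a], as the coordinates of a vector must share [m] while
    their offsets are 1/2 or 0. *)
Lemma approx_odd_denominator (R : realType) (e : R) : 0 < e ->
  exists2 m, odd m & forall t a : R, 0 <= a <= 1 ->
    exists b : int, `|t - (b%:~R + a) / m%:R| < e.
Proof.
move=> e0.
have [k /= _ /(_ k (leqnn k)) ke] := near_infty_natSinv_lt (PosNum e0).
exists k.*2.+1; first by rewrite /= odd_double.
set m : R := k.*2.+1%:R; have m0 : 0 < m by rewrite ltr0n.
move=> t a /andP[a0 a1]; exists (Num.floor (m * t)).
have me : m^-1 < e.
  apply: le_lt_trans ke; rewrite lef_pV2 ?posrE ?ltr0n// ler_nat ltnS.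
  by rewrite -addnn leq_addr.
apply: le_lt_trans me.
have -> : t - ((Num.floor (m * t))%:~R + a) / m =
    (m * t - (Num.floor (m * t))%:~R - a) / m.
  by field; rewrite gt_eqF.
rewrite normrM (@gtr0_norm _ m^-1) ?invr_gt0// ler_piMl ?invr_ge0 ?(ltW m0)//.
(* The fractional part of [m * t] and [a] both lie in [0, 1], so their difference has absolute value
   at most 1. *)
have := floor_le_tmp (m * t); have := floorD1_gt (m * t).
rewrite intrD ler_norml; lra.
Qed.

(** The phase changes by (b + 1/2) c with c odd; for c = 2h + 1 this is 1/2 plus the integer b + 2bh
    + h. *)
Lemma monomial_half_shift (R : realType) (d m n : nat) (b : int) (x : R) :
  odd m -> (0 < d)%N -> x = (b%:~R + 2^-1) / m%:R ->
  x * (n + m)%:R ^+ d - x * n%:R ^+ d - 2^-1 \is a Num.int.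
Proof.
move=> om d0 ->; have [c cE /(_ d0 om) oc] := expn_shift n m d.
have m0 : m%:R != 0 :> R by rewrite pnatr_eq0; case: (m) om.
rewrite -!natrX cE natrD natrM.
have -> : c%:R = 1 + 2 * c./2%:R :> R.
  by rewrite -{1}[c]odd_double_half oc natrD -mul2n natrM.
rewrite (_ : _ - _ = b%:~R + 2 * b%:~R * c./2%:R + c./2%:R); last first.
  by field.
by rewrite !rpredD ?rpredM ?natr_int ?intr_int.
Qed.

Lemma weyl_half_shift (R : realType) (d m n : nat) (b : 'I_d -> int)
    (x : 'I_d -> R) :
  (0 < d)%N -> (0 < m)%N ->
  (forall i, x i = ((b i)%:~R + (i == 0 :> nat)%:R / 2) / m%:R) ->
  \sum_(i < d) x i * (n + m)%:R ^+ i.+1 - \sum_(i < d) x i * n%:R ^+ i.+1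
    - 2^-1 \is a Num.int.
Proof.
move=> d0 m0 xb; have {}m0 : m%:R != 0 :> R by rewrite pnatr_eq0 -lt0n.
(* The 1/2 is charged to the linear coordinate, so that integrality can be checked term by term. *)
have -> : 2^-1 = \sum_(i < d) (i == 0 :> nat)%:R / 2 :> R.
  case: (d) d0 => // d' _; rewrite big_ord_recl big1 ?addr0 ?mul1r//.
  by move=> i _; rewrite mul0r.
rewrite -!sumrB; apply: rpred_sum => i _.
rewrite xb; case: (nat_of_ord i) => [|j] /=.
  rewrite !expr1 natrD (_ : _ - _ = (b i)%:~R) ?intr_int//.
  by field.
have [c cE _] := expn_shift n m j.+2.
rewrite -!natrX cE natrD natrM (_ : _ - _ = (b i)%:~R * c%:R).
  by rewrite rpredM ?intr_int ?natr_int.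
by field.
Qed.

Theorem theorem1p10 (R : realType) (d : nat) (hd : (2 <= d)%N) :
  contains_dense_Gdelta (@ZW R d) /\ contains_dense_Gdelta (@ZG R d).
Proof.
have d0 : (0 < d)%N by exact: ltnW.
have normc_ge0 (z : R[i]) : 0 <= Normc.normc z.
  by case: z => ? ?; exact: sqrtr_ge0.
have zeros (m : nat) (f : nat -> R[i]) : (0 < m)%N ->
    (forall n, f (n + m)%N = - f n) -> forall k, exists2 N, (k <= N)%N &
    Normc.normc (\sum_(1 <= n < N.+1) f n) = 0.
  (* A multiple of the full period [2m] that is at least [k]. *)
  move=> m0 fm k; exists (k * m.*2)%N.
    by rewrite leq_pmulr// double_gt0.
  by rewrite sum_antiperiodic// Normc.normc0.
split.
- pose D := [set t : 'rV[R]_d | exists2 m, (0 < m)%N & exists b : 'I_d -> int,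
    forall i, t 0 i = ((b i)%:~R + (i == 0 :> nat)%:R / 2) / m%:R].
  apply: (@contains_dense_Gdelta_liminf _ _
    (fun N (x : torus R d) => Normc.normc (weyl_sum x N)) (@torus_pi R d @` D)).
  + by move=> N; apply: continuous_normc; exact: weyl_sum_continuous.
  + by [].
  + apply: dense_image; first exact: torus_pi_continuous.
      move=> x; exists (\row_i repr (x i)); apply/funext => i.
      by rewrite /torus_pi mxE reprK.
    move=> O [t Ot] oO.
    have /nbhs_ballP[e /= e0 eO] : nbhs t O by exact: open_nbhs_nbhs.
    have [m om mP] := approx_odd_denominator e0.
    have aP (i : 'I_d) : 0 <= ((i == 0 :> nat)%:R / 2 : R) <= 1.
      by case: (_ == _) => /=; lra.
    have [b bP] := choice (fun i => mP (t 0 i) _ (aP i)).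
    exists (\row_i (((b i)%:~R + (i == 0 :> nat)%:R / 2) / m%:R)); split.
      by apply: eO; split=> // i j; rewrite (ord1 i) mxE; exact: bP.
    by exists m; [case: (m) om|exists b => i; rewrite mxE].
  + move=> _ [t [m m0 [b tb]] <-] k.
    pose f n : R[i] := expi (2 * pi * \sum_(i < d) t 0 i * n%:R ^+ i.+1).
    have [n|N kN fN] := zeros m f m0 _ k; last first.
      by exists N => //; rewrite weyl_sum_pi.
    exact/expi_half_turn/(weyl_half_shift _ d0 m0 tb).
- pose D := [set t : R | exists2 m, odd m & exists b : int,
    t = (b%:~R + 2^-1) / m%:R].
  apply: (@contains_dense_Gdelta_liminf _ _
    (fun N (x : torus1 R) => Normc.normc (monomial_sum d x N))
    (\pi_(torus1 R) @` D)).
  + by move=> N; apply: continuous_normc; exact: monomial_sum_continuous.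
  + by [].
  + apply: dense_image; first exact: torus1_pi_continuous.
      by move=> x; exists (repr x); rewrite reprK.
    move=> O [t Ot] oO.
    have /nbhs_ballP[e /= e0 eO] : nbhs t O by exact: open_nbhs_nbhs.
    have [m om mP] := approx_odd_denominator e0.
    have [|b bP] := mP t 2^-1; first by lra.
    exists ((b%:~R + 2^-1) / m%:R); split; first exact: eO.
    by exists m => //; exists b.
  + move=> _ [_ [m om [b ->]] <-] k.
    have m0 : (0 < m)%N by case: (m) om.
    have [n|N kN fN] := zeros m (fun n => expi
      (2 * pi * ((b%:~R + 2^-1) / m%:R * n%:R ^+ d))) m0 _ k; last first.
      by exists N => //; rewrite monomial_sum_pi.
    exact/expi_half_turn/(monomial_half_shift _ om d0 erefl).
Qed.
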